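(* Let $T$ be an automorphism of the locally compact, totally disconnected group $\mathcal{G}$ (second countable and Hausdorff, with $T$ continuous). If the points with compact $T$-orbit closure are not dense in $\mathcal{G}$, then the values of the scale function at $T$ and at $T^{-1}$ are the cardinalities of the follower sets and of the predecessor sets, respectively, in any of the essentially wandering countable state Markov shifts of the structure theorem for $(\mathcal{G},T)$, that is, the theorem that $(\mathcal{G},T)$ is then topologically conjugate to an inverse limit of systems, each of which is the product of a full-shift on a finite alphabet and an essentially wandering countable state Markov shift (the theorem and the shifts it produces are recalled in the context).
   Context: Scale: the scale of an automorphism $S$ of $\mathcal{G}$ is $s(S)=\min\{[S(\mathcal{H}):S(\mathcal{H})\cap\mathcal{H}]\}$, the minimum being over all compact, open subgroups $\mathcal{H}$ of $\mathcal{G}$. Coding: for a compact, open subgroup $\mathcal{H}$, the countable coset space $\mathcal{G}/\mathcal{H}$ is regarded as a discrete alphabet. The coding map $\pi:\mathcal{G}\to(\mathcal{G}/\mathcal{H})^{\mathbb{Z}}$ (product topology) assigns to each point its coset itinerary under $T$, $\pi(x)_j=T^j(x)\mathcal{H}$. The follower set of a symbol $x\mathcal{H}$ consists of the cosets $y\mathcal{H}$ with $T(x\mathcal{H})\cap y\mathcal{H}\neq\emptyset$, and its predecessor set consists of the cosets $y\mathcal{H}$ with $T^{-1}(x\mathcal{H})\cap y\mathcal{H}\neq\emptyset$. The cardinality of either is the number of cosets it contains; it is finite and the same for all symbols. The coset partition of $\mathcal{H}$ is memoryless if $\pi(\mathcal{G})$ with the shift $\sigma$, $\sigma(x)_i=x_{i+1}$,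 is a one-step, locally compact, countable state Markov shift; it is then denoted $(\Sigma_{\mathcal{G}/\mathcal{H}},\sigma)$. Essentially wandering: a system $(X,S)$, with $X$ an infinite topological space and $S$ a homeomorphism of $X$, is essentially wandering if the number of points with compact $S$-orbit closure is countable and each such point is periodic, and $X$ contains points with a noncompact orbit closure. Structure theorem (case where the points with compact $T$-orbit closure are not dense): $(\mathcal{G},T)$ is topologically conjugate to an inverse limit of systems that are the product of a full-shift on a finite alphabet and an essentially wandering countable state Markov shift. It is obtained as follows. Choose a nested sequence of compact, open subgroups $\mathcal{H}_n$, $n\in\mathbb{N}$, each with memoryless coset partition, with $\bigcap_n\mathcal{H}_n=\{e\}$. The $n$-th system is $(\Sigma_{\mathcal{G}/\mathcal{H}_n},\sigma)$, and the bonding maps are the 1-block maps defined by inclusion of cosets. For each $\mathcal{H}=\mathcal{H}_n$, let $\mathcal{G}_t$ be the closure of the set of points $x\in\mathcal{G}$ for which there is an $N\in\mathbb{N}$ with $T^k(x)\in\mathcal{H}$ for all $|k|\geq N$; it is a closed, $T$-invariant subgroup, and its image in $\Sigma_{\mathcal{G}/\mathcal{H}}$ is topologically conjugate to a full-shift on a finite alphabet. Let $F_t$ be the finite collection of all cosets of $\mathcal{H}$ that contain a periodic point whose $T$-orbit passes through $\mathcal{H}$, and let $C_{F_t}=\bigcup_{g\mathcal{H}\in F_t}g\mathcal{H}$, so that $\mathcal{G}_t=\bigcap_{j\in\mathbb{Z}}T^j(C_{F_t})$. One produces a compact, open subgroup $\mathcal{U}$ of $\mathcal{G}$ with memoryless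 coset partition and $\mathcal{G}_t\subseteq\mathcal{U}\subseteq C_{F_t}$; then $\bigcap_{j\in\mathbb{Z}}T^j(\mathcal{U})=\mathcal{G}_t$, and $(\Sigma_{\mathcal{G}/\mathcal{U}},\sigma)$ is topologically conjugate to $\mathcal{G}/\mathcal{G}_t$ with the map induced by $T$. This $(\Sigma_{\mathcal{G}/\mathcal{U}},\sigma)$ is the essentially wandering countable state Markov shift at level $n$, and $(\Sigma_{\mathcal{G}/\mathcal{H}},\sigma)$ is topologically conjugate to the product of it with the full-shift. *)

(* Defs.v *)
From HB Require Import structures.
From mathcomp Require Import all_boot all_order all_algebra.
From mathcomp Require Import all_classical all_reals all_analysis.

Set Implicit Arguments.
Unset Strict Implicit.
Unset Printing Implicit Defensive.

Local Open Scope classical_set_scope.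
Local Open Scope card_scope.
Local Open Scope group_scope.

(** Topological groups, not necessarily commutative and not assumed
    Hausdorff. *)
HB.mixin Record isTopologicalGroup G of Topological G & Group G := {
  mulg_continuous : continuous (fun x : G * G => x.1 * x.2);
  invg_continuous : continuous (fun x : G => x^-1)
}.

#[short(type="topologicalGroupType")]
HB.structure Definition TopologicalGroup :=
  {G of Topological G & Group G & isTopologicalGroup G}.

(** An automorphism is given by a map [T] together with its two-sided inverse
    [Tinv]; [zpow T Tinv j] is the power T^j. *)
Definition zpow (X : Type) (T Tinv : X -> X) (j : int) : X -> X :=
  match j with Posz n => iter n T | Negz n => iter n.+1 Tinv end.

Definition zorbit (X : Type) (T Tinv : X -> X) (x : X) : set X :=
  range (fun j : int => zpow T Tinv j x).

Definition periodic (X : Type) (T : X -> X) (x : X) : Prop :=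
  exists2 p : nat, (0 < p)%N & iter p T x = x.

(** One-step, locally compact, countable state Markov shifts over the set of
    symbols [A]: the space of all bi-infinite sequences of symbols whose
    consecutive terms are related by a fixed transition relation [E], with the
    topology induced by the product of the discrete topologies.  Such a space is
    invariant under the shift (sigma x)_i = x_(i+1). *)
Definition one_step_markov_shift (S : choiceType) (A : set S)
    (X : set {ptws int -> discrete_topology S}) : Prop :=
  [/\ countable A,
      exists E : S -> S -> Prop,
        X = [set x | (forall i, A (x i)) /\ (forall i, E (x i) (x (i + 1)%R))]
    & locally_compact [set: set_type X]].

Section Groups.
Variable G : topologicalGroupType.
Implicit Types (H A : set G) (S T Tinv : G -> G).

Definition subgroup H : Prop :=
  [/\ H 1, forall x y, H x -> H y -> H (x * y) & forall x, H x -> H x^-1].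

Definition compact_open_subgroup H : Prop :=
  [/\ subgroup H, compact H & open H].

Definition left_coset (x : G) H : set G := [set x * h | h in H].

(** The coset space G/H, as a set of subsets of G. *)
Definition cosets H : set (set G) := range (left_coset^~ H).

(** [has_index A B n]: there are exactly n left cosets of B with
    representatives in A, i.e. [A : B] = n when B <= A are subgroups. *)
Definition has_index A (B : set G) (n : nat) : Prop :=
  [set left_coset a B | a in A] #= `I_n.

Definition displacement_indices S : set nat :=
  [set n | exists2 H, compact_open_subgroup H
                    & has_index (S @` H) (S @` H `&` H) n].

(** The least element of [displacement_indices S]; the default value 0 is taken
    only if no compact open subgroup has a finite displacement index. *)
Definition scale S : nat :=
  xget 0%N [set n | displacement_indices S n /\
                    forall m, displacement_indices S m -> (n <= m)%N].

(** The coset itinerary pi(x)_j = T^j(x) H. *)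
Definition coding T Tinv H (x : G) : {ptws int -> discrete_topology (set G)} :=
  fun j => left_coset (zpow T Tinv j x) H.

Definition memoryless T Tinv H : Prop :=
  one_step_markov_shift (cosets H) (range (coding T Tinv H)).

Definition follower_set T H (A : set G) : set (set G) :=
  [set B | cosets H B /\ T @` A `&` B !=set0].

Definition predecessor_set T H (A : set G) : set (set G) :=
  [set B | cosets H B /\ T @^-1` A `&` B !=set0].

(** The subgroup G_t: the closure of the points homoclinic to H. *)
Definition homoclinic_closure T Tinv H : set G :=
  closure [set x | exists N : nat,
    forall k : int, (N <= `|k|)%N -> H (zpow T Tinv k x)].

(** The collection F_t; periodicity is that of a point of G under T. *)
Definition transitive_cosets T Tinv H : set (set G) :=
  [set A | cosets H A /\
    exists x, [/\ A x, periodic T x & zorbit T Tinv x `&` H !=set0]].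

(** The data of the structure theorem: the subgroups H_n whose Markov shifts
    form the inverse system, and, for each n, the subgroup U_n such that the
    shift on (G/U_n)^Z is the essentially wandering factor at level n. *)
Record structure_data T Tinv (H U : nat -> set G) : Prop := {
  level_compact_open : forall n, compact_open_subgroup (H n);
  level_memoryless : forall n, memoryless T Tinv (H n);
  level_nested : forall n, H n.+1 `<=` H n;
  level_trivial : \bigcap_n H n = [set 1];
  wandering_compact_open : forall n, compact_open_subgroup (U n);
  wandering_memoryless : forall n, memoryless T Tinv (U n);
  homoclinic_sub_wandering :
    forall n, homoclinic_closure T Tinv (H n) `<=` U n;
  wandering_sub_transitive :
    forall n, U n `<=` \bigcup_(A in transitive_cosets T Tinv (H n)) A
}.

End Groups.

(* Main.v *)
(** Memorylessness of the coset partition of [U] says that itineraries sharing a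
    symbol can be spliced, and the sandwich [G_t <= U <= C_(F_t)] forces an orbit
    segment starting and ending in [U] to remain in [U].  Together these give
    [[T^n U : T^n U `&` U] = d^n], with [d] the size of the follower sets.  For
    any other compact open [V] with displacement index [m], commensurability of
    [U] and [V] bounds the same number by [C * m^n]; hence [d <= m].  The
    situation is symmetric in [T] and [T^-1], except that finiteness of the
    predecessor sets comes from local compactness of the Markov shift. *)

Require Import Defs.
From HB Require Import structures.
From mathcomp Require Import all_boot all_order all_algebra.
From mathcomp Require Import all_classical all_reals all_analysis.
From mathcomp Require Import zify.

Set Implicit Arguments.
Unset Strict Implicit.
Unset Printing Implicit Defensive.

Import Order.TTheory GRing.Theory Num.Theory.

Local Open Scope classical_set_scope.
Local Open Scope card_scope.
Local Open Scope group_scope.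

(** * Integer powers of a bijection *)

Lemma can_iter (X : Type) (f g : X -> X) n :
  cancel f g -> cancel (iter n f) (iter n g).
Proof. by move=> fK; elim: n => [//|n IH] x; rewrite iterSr /= fK IH. Qed.

Section IntegerPowers.
Variables (X : Type) (T Tinv : X -> X).
Hypotheses (TK : cancel T Tinv) (TinvK : cancel Tinv T).

Lemma zpowS j x : zpow T Tinv (j + 1)%R x = T (zpow T Tinv j x).
Proof.
case: j => [n|[|n]]; first by rewrite (_ : (Posz n + 1)%R = Posz n.+1) //; lia.
  by rewrite /= TinvK.
by rewrite (_ : (Negz n.+1 + 1)%R = Negz n) /= ?TinvK//; lia.
Qed.

Lemma zpowB1 j x : zpow T Tinv (j - 1)%R x = Tinv (zpow T Tinv j x).
Proof. by rewrite -{2}(subrK 1%R j) zpowS TK. Qed.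

Lemma zpowD i j x : zpow T Tinv (i + j)%R x = zpow T Tinv i (zpow T Tinv j x).
Proof.
elim/int_rect: i => [|n IH|n IH]; first by rewrite add0r.
  by rewrite -addn1 PoszD addrAC !zpowS IH.
by rewrite -addn1 PoszD opprD addrAC !zpowB1 IH.
Qed.

Lemma zpowN j x : zpow Tinv T (- j)%R x = zpow T Tinv j x.
Proof. by case: j => [[|n]|n]. Qed.

Lemma zpow_periodic p k x : iter p T x = x ->
  zpow T Tinv (p%:Z * k)%R x = x.
Proof.
move=> px; elim/int_rect: k => [|n IH|n IH]; first by rewrite mulr0.
  by rewrite -addn1 PoszD mulrDr mulr1 zpowD -{2}IH -[zpow _ _ p x]/(iter p T x) px.
rewrite -addn1 PoszD opprD mulrDr mulrN1 zpowD.
by rewrite -{1}px -[iter p T x]/(zpow T Tinv p x) -(zpowD _ p) addNr.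
Qed.

Lemma zorbit_ge x (A : set X) (m : int) :
    Defs.periodic T x -> zorbit T Tinv x `&` A !=set0 ->
  exists2 k : int, (m <= k)%R & A (zpow T Tinv k x).
Proof.
move=> [p p0 px] [_ [[k _ <-] Ak]].
(* Adding [|m| + |k|] periods carries the visit past time [m], since [p] is at least 1. *)
exists (k + p%:Z * (`|m| + `|k|)%N%:Z)%R; last by rewrite zpowD zpow_periodic.
by nia.
Qed.

End IntegerPowers.

(** * Left cosets of a subgroup *)

Section Cosets.
Variable G : topologicalGroupType.
Implicit Types (H : set G) (x y a : G).

Lemma subgroup1 H : subgroup H -> H 1. Proof. by case. Qed.

Lemma subgroupM H x y : subgroup H -> H x -> H y -> H (x * y).
Proof. by move=> [_ + _]; exact. Qed.

Lemma subgroupV H x : subgroup H -> H x -> H x^-1.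
Proof. by move=> [_ _]; exact. Qed.

Lemma mem_left_coset x H y : left_coset x H y <-> H (x^-1 * y).
Proof.
split=> [[h Hh <-]|Hxy]; first by rewrite mulKg.
by exists (x^-1 * y) => //; rewrite mulVKg.
Qed.

Lemma eq_left_coset x y H : subgroup H ->
  left_coset x H = left_coset y H <-> H (x^-1 * y).
Proof.
move=> sH; split=> [xy|Hxy].
  by apply/mem_left_coset; rewrite xy mem_left_coset mulVg; exact: subgroup1.
apply/seteqP; split=> z /mem_left_coset Hz; apply/mem_left_coset.
  rewrite (_ : y^-1 * z = (x^-1 * y)^-1 * (x^-1 * z)); last first.
    by rewrite invgM invgK -!mulgA mulVKg.
  by apply: subgroupM => //; exact: subgroupV.
by rewrite (_ : _ * z = x^-1 * y * (y^-1 * z));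
  [exact: subgroupM|rewrite -!mulgA mulVKg].
Qed.

Lemma left_coset_refl x H : subgroup H -> left_coset x H x.
Proof. by move=> sH; apply/mem_left_coset; rewrite mulVg; exact: subgroup1. Qed.

Lemma cosets_eq A x H : subgroup H -> cosets H A -> A x -> A = left_coset x H.
Proof. by move=> sH [y _ <-] /mem_left_coset xA; exact/eq_left_coset. Qed.

Lemma left_coset1E x H : subgroup H -> left_coset x H = left_coset 1 H <-> H x.
Proof.
move=> sH; split=> [/esym/eq_left_coset|Hx]; first by rewrite invg1 mul1g; exact.
by apply/esym/eq_left_coset => //; rewrite invg1 mul1g.
Qed.

End Cosets.

(** * Automorphisms and coset itineraries *)

Section Automorphism.
Variables (G : topologicalGroupType) (T : G -> G).
Hypothesis (TM : {morph T : x y / x * y}).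

Lemma morph1 : T 1 = 1.
Proof. by apply: (@mulgI _ (T 1)); rewrite -TM !mulg1. Qed.

Lemma morphV x : T x^-1 = (T x)^-1.
Proof. by apply: (@mulgI _ (T x)); rewrite -TM !mulgV morph1. Qed.

Lemma morph_iter n : {morph iter n T : x y / x * y}.
Proof. by elim: n => [//|n IH] x y /=; rewrite IH TM. Qed.

End Automorphism.

Lemma can_morphM (G : topologicalGroupType) (T Tinv : G -> G) :
  cancel T Tinv -> cancel Tinv T -> {morph T : x y / x * y} ->
  {morph Tinv : x y / x * y}.
Proof. by move=> TK TinvK TM x y; apply: (can_inj TK); rewrite TM !TinvK. Qed.

(* The Markov property of the coset coding. *)
Definition splicing (G : topologicalGroupType) (T Tinv : G -> G) (H : set G) :=
  forall x y k, coding T Tinv H x k = coding T Tinv H y k ->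
  exists z, (forall j, (j <= k)%R -> coding T Tinv H z j = coding T Tinv H x j) /\
            (forall j, (k <= j)%R -> coding T Tinv H z j = coding T Tinv H y j).

Section Coding.
Variables (G : topologicalGroupType) (T Tinv : G -> G).
Hypotheses (TK : cancel T Tinv) (TinvK : cancel Tinv T).
Hypothesis (TM : {morph T : x y / x * y}).
Implicit Types (H U : set G).

Let TinvM := can_morphM TK TinvK TM.

Lemma zpowM j : {morph zpow T Tinv j : x y / x * y}.
Proof. by case: j => n; exact: morph_iter. Qed.

Lemma zpow1 j : zpow T Tinv j 1 = 1.
Proof. exact/morph1/zpowM. Qed.

Lemma zpowV j x : zpow T Tinv j x^-1 = (zpow T Tinv j x)^-1.
Proof. exact/morphV/zpowM. Qed.

Lemma coding1 H x j : subgroup H ->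
  coding T Tinv H x j = coding T Tinv H 1 j <-> H (zpow T Tinv j x).
Proof. by move=> sH; rewrite /coding zpow1; exact: left_coset1E. Qed.

Lemma codingP H x y j : subgroup H ->
  coding T Tinv H x j = coding T Tinv H y j <-> H (zpow T Tinv j (x^-1 * y)).
Proof. by move=> sH; rewrite zpowM zpowV; exact: eq_left_coset. Qed.

Lemma coding_sym H x j : coding Tinv T H x j = coding T Tinv H x (- j)%R.
Proof. by rewrite /coding -zpowN. Qed.

Lemma splicing_sym H : splicing T Tinv H -> splicing Tinv T H.
Proof.
move=> spl x y k; rewrite !coding_sym => /esym /spl [z [zx zy]]; exists z.
by split=> j jk; rewrite !coding_sym; [apply: zy|apply: zx]; lia.
Qed.

Lemma coding_in_cosets H x j : cosets H (coding T Tinv H x j).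
Proof. by exists (zpow T Tinv j x). Qed.

(** The concatenation [c] of the two itineraries obeys the transition relation [E] at every step,
    the crossing step included because both show the same symbol at time [k]; hence [c] is itself an
    itinerary. *)
Lemma memoryless_splicing H : memoryless T Tinv H -> splicing T Tinv H.
Proof.
move=> [_ [E defX] _] x y k xyk.
have step w j : E (coding T Tinv H w j) (coding T Tinv H w (j + 1)%R).
  have : range (coding T Tinv H) (coding T Tinv H w) by exists w.
  by rewrite defX => -[_]; exact.
pose c j := if (j <= k)%R then coding T Tinv H x j else coding T Tinv H y j.
have : range (coding T Tinv H) c.
  rewrite defX /=; split=> i; rewrite /c.
    by case: ifP => _; exact: coding_in_cosets.
  case: (boolP (i <= k)%R) => ik; case: (boolP (i + 1 <= k)%R) => ik1;
    [exact: step| |lia|exact: step].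
  have -> : i = k by apply/le_anti; rewrite ik leNgt -lezD1.
  by rewrite xyk; exact: step.
move=> [z _ zc]; exists z; rewrite zc /c; split=> j jk; first by rewrite jk.
by case: ifP => // kj; have -> : j = k by lia.
Qed.

End Coding.

(** * Compactness and finite orbit windows *)

Lemma iter_continuous (X : topologicalType) (T : X -> X) n :
  continuous T -> continuous (iter n T).
Proof.
move=> cT; elim: n => [|n IH] x; first exact: cvg_id.
by apply: (@continuous_comp _ _ _ (iter n T) T); [exact: IH|exact: cT].
Qed.

Lemma closed_zpow_preimage (X : topologicalType) (T Tinv : X -> X) (H : set X) j :
  hausdorff_space X -> cancel T Tinv -> cancel Tinv T -> continuous T ->
  compact H -> closed (zpow T Tinv j @^-1` H).
Proof.
move=> hX TK TinvK cT cH.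
have clH := compact_closed hX cH.
case: j => n /=.
  by apply: preimage_closed => // x _; exact: iter_continuous.
(* Continuity is assumed for [T] only, so the preimage under a negative power is rewritten as the
   image of the compact [H] under a positive power of [T]. *)
rewrite (_ : _ @^-1` H = iter n.+1 T @` H).
  apply: compact_closed => //; apply: continuous_compact => //.
  by apply: continuous_subspaceT; exact: iter_continuous.
apply/seteqP; split=> [x Hx|_ [x Hx <-]].
  by exists (iter n.+1 Tinv x) => //; exact: (can_iter n.+1 TinvK).
by change (H (iter n.+1 Tinv (iter n.+1 T x))); rewrite (can_iter n.+1 TK).
Qed.

(* The sets [{x | T^j x \in H for |j| <= m}] are compact and decrease to a subset
   of the open set [U], so one of them lies in [U]. *)
Lemma finite_window (X : topologicalType) (T Tinv : X -> X) (H U : set X) :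
  hausdorff_space X -> cancel T Tinv -> cancel Tinv T -> continuous T ->
  compact H -> open U -> (forall x, (forall j, H (zpow T Tinv j x)) -> U x) ->
  exists m : nat,
    forall x, (forall j, (`|j| <= m)%N -> H (zpow T Tinv j x)) -> U x.
Proof.
move=> hX TK TinvK cT cH oU HU.
have cHU : compact (H `\` U).
  by apply: compact_closedI => //; exact: open_closedC.
pose P (m : nat) x := ~ forall j, (`|j| <= m)%N -> H (zpow T Tinv j x).
have [m _ Hm] : \forall m \near \oo, H `\` U `<=` P m; last first.
  exists m => x Hx; apply: contrapT => nUx; apply: (Hm m _ x) => //=.
  by split=> //; exact: (Hx 0).
(* Each point of [H] outside [U] leaves [H] at some time [j]; so do its neighbours, and every window
   with [m >= |j|] detects it. Compactness makes [m] uniform. *)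
apply: ((compact_near_coveringP _).1 cHU nat \oo P _) => x [_ nUx].
have [j Hj] : exists j, ~ H (zpow T Tinv j x).
  apply: contrapT => nx; apply/nUx/HU => j.
  by apply: contrapT => nHj; apply: nx; exists j.
exists (~` (zpow T Tinv j @^-1` H), [set m | (`|j| <= m)%N]) => /=.
  split; last by exists `|j|%N.
  apply: open_nbhs_nbhs; split; last exact: Hj.
  by apply: closed_openC; exact: closed_zpow_preimage.
by move=> [y m] /= [nHy jm] Hy; apply/nHy/Hy.
Qed.

(** * Orbit segments that start and end in [U] *)

Section Transitivity.
Variables (G : topologicalGroupType).
Implicit Types (H U : set G) (T Tinv : G -> G).

Lemma transitive_cosets_sym T Tinv H : cancel T Tinv ->
  transitive_cosets T Tinv H `<=` transitive_cosets Tinv T H.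
Proof.
move=> TK A [cA [x [Ax [p p0 px] [_ [[k _ <-] Hk]]]]]; split=> //; exists x.
split=> //.
  exists p => //; rewrite -{1}px; exact: can_iter.
by exists (zpow T Tinv k x); split=> //; exists (- k)%R; rewrite // zpowN.
Qed.

(* Continue past time [j] along a periodic point that visits [H], and stay in [H]
   from then on. *)
Lemma future_in T Tinv H y j :
  cancel T Tinv -> cancel Tinv T -> {morph T : x y / x * y} ->
  subgroup H -> splicing T Tinv H ->
  transitive_cosets T Tinv H (coding T Tinv H y j) ->
  exists v, (forall i, (i <= j)%R -> coding T Tinv H v i = coding T Tinv H y i) /\
            exists N, forall i, (N <= i)%R -> H (zpow T Tinv i v).
Proof.
move=> TK TinvK TM sH spl [_ [p [yp per orb]]].
have [k k0 Hk] := zorbit_ge TK TinvK (0%R : int) per orb.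
(* The periodic point [p] is delayed by [j], so that it shares the symbol of [y] at time [j] and
   visits [H] at time [j + k], where the identity can be spliced in. *)
have [|v [vy vp]] := spl y (zpow T Tinv (- j)%R p) j.
  rewrite [RHS]/coding -zpowD// addrN /=.
  by apply: cosets_eq => //; exact: coding_in_cosets.
have [|w [wv w1]] := spl v 1 (j + k)%R.
  apply/coding1 => //; rewrite -(coding1 TK TinvK) // vp; last lia.
  by rewrite coding1 // -zpowD // (_ : (j + k - j = k)%R); last lia.
exists w; split=> [i ij|]; first by rewrite wv ?vy//; lia.
by exists (j + k)%R => i /w1; rewrite coding1.
Qed.

(** Time reversal of [future_in]. *)
Lemma past_in T Tinv H y j :
  cancel T Tinv -> cancel Tinv T -> {morph T : x y / x * y} ->
  subgroup H -> splicing T Tinv H ->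
  transitive_cosets T Tinv H (coding T Tinv H y j) ->
  exists v, (forall i, (j <= i)%R -> coding T Tinv H v i = coding T Tinv H y i) /\
            exists N, forall i, (i <= N)%R -> H (zpow T Tinv i v).
Proof.
move=> TK TinvK TM sH spl /(transitive_cosets_sym TK).
rewrite -[j]opprK -coding_sym => /future_in[]//; first exact: can_morphM TM.
  exact: splicing_sym.
move=> v [vy [N HN]]; exists v; split=> [i ji|].
  by have := vy (- i)%R; rewrite !(@coding_sym _ T Tinv) opprK; apply; lia.
exists (- N)%R => i iN; by have := HN (- i)%R; rewrite zpowN; apply; lia.
Qed.

End Transitivity.

(* Splicing with the identity on both sides of [[0, n]] gives a point [z] that
   stays in [U] outside [[0, n]].  In the coding by [H] every long window of [z]
   is matched by a point homoclinic to [H], hence lying in [U]; so [z], and with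
   it the given orbit segment, never leaves [U]. *)
Lemma orbit_segment_stays (G : topologicalGroupType) (T Tinv : G -> G)
  (H U : set G) n x i :
  hausdorff_space G -> cancel T Tinv -> cancel Tinv T ->
  {morph T : x y / x * y} -> continuous T ->
  compact_open_subgroup H -> splicing T Tinv H ->
  compact_open_subgroup U -> splicing T Tinv U ->
  homoclinic_closure T Tinv H `<=` U ->
  U `<=` \bigcup_(A in transitive_cosets T Tinv H) A ->
  U x -> U (iter n T x) -> (i <= n)%N -> U (iter i T x).
Proof.
move=> hG TK TinvK TM cT [sH cH oH] splH [sU cU oU] splU PU UF Ux Unx le_in.
have [|z1 [z1past z1fut]] := splU 1 x 0%R.
  by apply/esym/(coding1 TK TinvK).
have [|z [zpast zfut]] := splU z1 1 (n : int).
  by rewrite z1fut //; apply/(coding1 TK TinvK TM).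
have zU (j : int) : (j <= 0)%R \/ ((n : int) <= j)%R -> U (zpow T Tinv j z).
  move=> jn; rewrite -(coding1 TK TinvK) //.
  by case: jn => jn; [rewrite zpast ?z1past //; lia|exact: zfut].
have zx : coding T Tinv U z (i : int) = coding T Tinv U x (i : int).
  by rewrite zpast ?z1fut //; lia.
suff Uy : U (zpow T Tinv (i : int) z).
  by apply/(coding1 TK TinvK TM x (i : int) sU); rewrite -zx; apply/coding1.
set y := zpow T Tinv _ z.
have [m Hm] : exists m : nat,
    forall x, (forall j, (`|j| <= m)%N -> H (zpow T Tinv j x)) -> U x.
  (* A point whose whole orbit lies in [H] is trivially homoclinic to [H], hence in [U]. *)
  apply: finite_window => // w Hw; apply: PU; apply: subset_closure.
  by exists 0%N.
(* Since [y] is [z] recentred at a time of [[0, n]], it lies in [U] outside [[-n, n]]. The bound [M]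
   exceeds both [n], so that the symbols at times [M] and [-M] are transitive, and the window radius
   [m]. *)
pose M : int := (m + n)%N.
have yF j : (j <= - (n : int))%R \/ ((n : int) <= j)%R ->
    transitive_cosets T Tinv H (coding T Tinv H y j).
  move=> jn; have [|A FA Ay] := UF (zpow T Tinv j y).
    by rewrite -zpowD //; apply: zU; lia.
  rewrite (_ : coding _ _ _ _ _ = A) //; apply/esym.
  by case: FA => cA _; exact: cosets_eq.
have [|v1 [v1y [N1 Hv1]]] := future_in (y := y) (j := M) TK TinvK TM sH splH.
  by apply: yF; lia.
have [|v [vv1 [N2 Hv]]] := past_in (y := v1) (j := (- M)%R) TK TinvK TM sH splH.
  by rewrite v1y; [apply: yF|]; lia.
have Uv : U v.
  apply/PU/subset_closure; exists (`|N1| + `|N2| + `|M|)%N => k kN.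
  case: (lerP 0 k) => k0; last by apply: Hv; lia.
  apply/(coding1 TK TinvK TM) => //; rewrite vv1; last by lia.
  by apply/coding1 => //; apply: Hv1; lia.
(* Since [v] and [y] have the same symbols on [[-M, M]], the orbit of [v^-1 * y] is in [H] for times
   up to [m] in absolute value, which puts [v^-1 * y] in [U]. *)
rewrite -(mulVKg v y); apply: subgroupM => //; apply: Hm => j jm.
by apply/codingP => //; rewrite vv1 ?v1y //; lia.
Qed.

(** * Counting cosets and growth rates *)

Section Coverings.
Variable G : topologicalGroupType.
Implicit Types (B U V W : set G) (T : G -> G).

(** The centres may lie outside [B] and may repeat, so [k] is only an upper bound for the number of
    cosets; this lets coverings compose. *)
Definition covered B V k := exists (I : finType) (f : I -> G),
  #|I| = k /\ forall x, B x -> exists i, V ((f i)^-1 * x).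

Definition separated B V k := exists (I : finType) (f : I -> G),
  [/\ #|I| = k, forall i, B (f i) & forall i j, V ((f i)^-1 * f j) -> i = j].

Lemma covered_sub B B' V k : B' `<=` B -> covered B V k -> covered B' V k.
Proof. by move=> sB [I [f [Ik cf]]]; exists I, f; split=> // x /sB /cf. Qed.

Lemma covered_trans B V W k l :
  covered B V k -> covered V W l -> covered B W (k * l).
Proof.
move=> [I [f [<- cf]]] [J [g [<- cg]]].
exists (I * J)%type, (fun p => f p.1 * g p.2); split; first by rewrite card_prod.
move=> x /cf[i /cg[j Wj]]; exists (i, j) => /=.
by rewrite invgM -mulgA.
Qed.

Lemma covered_image T B V k : {morph T : x y / x * y} ->
  covered B V k -> covered (T @` B) (T @` V) k.
Proof.
move=> TM [I [f [<- cf]]]; exists I, (T \o f); split=> // _ [x /cf[i Vi] <-].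
by exists i; exists ((f i)^-1 * x) => //=; rewrite TM (morphV TM).
Qed.

(** Pigeonhole: two points of the separated family in one covering coset differ by an element of
    [U]. *)
Lemma separated_leq_covered B U k l :
  subgroup U -> separated B U k -> covered B U l -> (k <= l)%N.
Proof.
move=> sU [I [f [<- Bf sf]]] [J [g [<- cg]]].
have /choice[h Uh] i : exists j, U ((g j)^-1 * f i) by exact/cg/Bf.
apply: (@leq_card _ _ h) => i j hij; apply: sf.
rewrite (_ : _ * _ = ((g (h i))^-1 * f i)^-1 * ((g (h j))^-1 * f j)).
  by apply: subgroupM => //; exact: subgroupV.
by rewrite hij invgM invgK -mulgA mulVKg.
Qed.

Lemma covered_iter T V m n : {morph T : x y / x * y} ->
  covered (T @` V) V m -> covered (iter n T @` V) V (m ^ n).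
Proof.
move=> TM cV; elim: n => [|n IH].
  exists unit, (fun=> 1); rewrite card_unit; split=> // _ [x Vx <-].
  by exists tt; rewrite invg1 mul1g.
rewrite expnSr; apply: covered_trans cV.
apply: covered_sub (covered_image TM IH) => _ [x Vx <-].
by exists (iter n T x) => //; exists x.
Qed.

Lemma cosets_card_representatives B V m :
  [set left_coset a V | a in B] #= `I_m ->
  exists f : 'I_m -> G, [/\ forall i, B (f i),
    forall x, B x -> exists i, left_coset x V = left_coset (f i) V &
    forall i j, left_coset (f i) V = left_coset (f j) V -> i = j].
Proof.
rewrite card_eq_sym => /card_set_bijP[g [gB gI gS]].
have /choice[f Hf] (i : 'I_m) : exists a, B a /\ left_coset a V = g i.
  by have [a Ba <-] := gB i (ltn_ord i); exists a.
exists f; split=> [i|x Bx|i j].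
- by have [] := Hf i.
- have [|k km gk] := gS (left_coset x V); first by exists x.
  by exists (Ordinal km); have [_ ->] := Hf (Ordinal km).
have [_ ->] := Hf i; have [_ ->] := Hf j => gij.
by apply/val_inj/gI => //; rewrite inE /=.
Qed.

Lemma card_cosets_covered B V m : subgroup V ->
  [set left_coset a V | a in B] #= `I_m -> covered B V m.
Proof.
move=> sV /cosets_card_representatives[f [_ cf _]].
exists 'I_m, f; rewrite card_ord; split=> // x /cf[i xi]; exists i.
by apply/eq_left_coset.
Qed.

Lemma card_cosets_separated B V m : subgroup V ->
  [set left_coset a V | a in B] #= `I_m -> separated B V m.
Proof.
move=> sV /cosets_card_representatives[f [Bf _ If]].
exists 'I_m, f; rewrite card_ord; split=> // i j.
by move/(eq_left_coset _ _ sV)/If.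
Qed.

Lemma subgroup_image T V : {morph T : x y / x * y} ->
  subgroup V -> subgroup (T @` V).
Proof.
move=> TM sV; split.
- by exists 1; [exact: subgroup1|exact: morph1].
- move=> _ _ [x Vx <-] [y Vy <-]; exists (x * y); last exact: TM.
  exact: subgroupM.
by move=> _ [x Vx <-]; exists x^-1; [exact: subgroupV|exact: morphV].
Qed.

Lemma subgroupI V W : subgroup V -> subgroup W -> subgroup (V `&` W).
Proof.
move=> [V1 VM VV] [W1 WM WV]; split=> //.
  by move=> x y [Vx Wx] [Vy Wy]; split; [exact: VM|exact: WM].
by move=> x [Vx Wx]; split; [exact: VV|exact: WV].
Qed.

Lemma index_covered T V m : {morph T : x y / x * y} -> subgroup V ->
  has_index (T @` V) (T @` V `&` V) m -> covered (T @` V) V m.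
Proof.
move=> TM sV /card_cosets_covered.
case; first by apply: subgroupI => //; exact: subgroup_image.
by move=> I [f [Im cf]]; exists I, f; split=> // x /cf[i [_ Vi]]; exists i.
Qed.

(** Both images are the quotient of [A] by the same equivalence relation; [h] sends [f a] to
    [g a]. *)
Lemma card_image_kernel (I J : Type) (J' : pointedType) (A : set I)
    (f : I -> J) (g : I -> J') :
  (forall a b, A a -> A b -> f a = f b <-> g a = g b) -> f @` A #= g @` A.
Proof.
move=> fg.
have /choice[h hP] (y : J) : exists z, forall a, A a -> f a = y -> g a = z.
  have [[a Aa <-]|nA] := pselect ((f @` A) y).
    by exists (g a) => b Ab /fg; exact.
  by exists point => a Aa ay; case: nA; exists a.
have -> : g @` A = h @` (f @` A).
  by rewrite image_comp; apply: eq_imagel => a Aa /=; exact: hP.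
rewrite card_eq_sym; apply: inj_card_eq => y z.
rewrite !inE => -[a Aa <-] [b Ab <-].
by rewrite -(hP (f a) a) // -(hP (f b) b) // => gab; exact/fg.
Qed.

Lemma has_indexI A B n : subgroup A -> subgroup B ->
  has_index A (A `&` B) n <-> [set left_coset a B | a in A] #= `I_n.
Proof.
move=> sA sB; rewrite /has_index.
rewrite (card_eql (B := [set left_coset a B | a in A])) //.
apply: card_image_kernel => a b Aa Ab.
rewrite !eq_left_coset //; last exact: subgroupI.
by split=> [[]//|Bab]; split=> //; apply: subgroupM => //; exact: subgroupV.
Qed.

(** Splicing the identity's past onto representatives gives points [u i] whose whole past is in [U]
    and whose images [T (u i)] represent the [d] cosets. Multiplying the [d ^ n] points [b j] of
    [T^n U] by them and applying [T] gives [d ^ n.+1] points of [T^(n+1) U]. *)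
Lemma separated_iter T Tinv U d n : cancel T Tinv -> cancel Tinv T ->
  {morph T : x y / x * y} -> subgroup U -> splicing T Tinv U ->
  (forall n x i, U x -> U (iter n T x) -> (i <= n)%N -> U (iter i T x)) ->
  separated (T @` U) U d -> separated (iter n T @` U) U (d ^ n).
Proof.
move=> TK TinvK TM sU spl stay [I [a [<- Ua sa]]].
have /choice[u /all_and2[uneg uT]] i : exists u,
    (forall k, U (iter k Tinv u)) /\ left_coset (T u) U = left_coset (a i) U.
  have [w Uw wa] := Ua i.
  have [|u [upast ufut]] := spl 1 w 0%R.
    by apply/esym/(coding1 TK TinvK).
  exists u; split=> [k|]; last first.
    by rewrite -wa; exact: (ufut (1 : int)).
  have -> : iter k Tinv u = zpow T Tinv (- (k : int))%R u by rewrite -zpowN opprK.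
  by apply/(coding1 TK TinvK TM _ _ sU); apply: upast; lia.
elim: n => [|n [J [b [Jn Ub sb]]]].
  exists unit, (fun=> 1); rewrite card_unit; split=> //; last by case=> -[].
  by exists 1; [exact: subgroup1|exact: (morph1 (morph_iter TM 0))].
exists (I * J)%type, (fun p => T (b p.2 * u p.1)).
split; first by rewrite card_prod Jn expnS.
  move=> [i j] /=; have [y Uy <-] := Ub j.
  exists (y * iter n Tinv (u i)); first exact: subgroupM.
  by rewrite /= (morph_iter TM) (can_iter n TinvK).
move=> [i j] [i' j'] /=; rewrite -(morphV TM) -TM => Ug.
set g := (b j * u i)^-1 * _ in Ug.
have gE : g = (u i)^-1 * (b j)^-1 * (b j' * u i') by rewrite /g invgM.
have [y Uy yg] : (iter n T @` U) g.
  have sT := subgroup_image (morph_iter TM n) sU.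
  have uU k : (iter n T @` U) (u k).
    by exists (iter n Tinv (u k)) => //; exact: can_iter.
  rewrite gE; apply: (subgroupM sT); apply: (subgroupM sT) => //;
    exact: subgroupV.
(* The segment from [y] to [T g] has both ends in [U], so its last intermediate point [g] is in [U];
   this separates the indices [j] first and then [i]. *)
have Ugn : U g.
  rewrite -yg; apply: (stay n.+1 y n Uy _ (leqnSn n)).
  by rewrite /= yg.
have uU k : U (u k) := uneg k 0%N.
have jj' : j = j'.
  apply: sb; rewrite (_ : _ * _ = u i * g * (u i')^-1); last first.
    by rewrite gE !mulgA mulgV mul1g mulgK.
  apply: subgroupM; [by []| |exact: subgroupV].
  by apply: subgroupM.
subst j'; congr (_, _); apply: sa; apply/eq_left_coset => //.
rewrite -!uT; apply/eq_left_coset => //.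
by rewrite -(morphV TM) -TM; move: Ug; rewrite gE -!mulgA mulKg.
Qed.

End Coverings.

(** If [m < d] with [m] positive, Bernoulli's inequality makes [((m + 1) / m) ^ n] at least
    [1 + n / m], which exceeds [C] at [n = C * m]; for [m = 0], [n = 1] suffices. *)
Lemma expn_growth_leq d m C : (forall n, d ^ n <= C * m ^ n)%N -> (d <= m)%N.
Proof.
move=> H; rewrite leqNgt; apply/negP => md.
case: m => [|m] in H md *; first by have := H 1%N; rewrite expn1 expn1; lia.
have Hm n : (m.+2 ^ n <= C * m.+1 ^ n)%N.
  by apply: leq_trans (H n); case: n => [|n]; rewrite ?expn0 ?leq_exp2r.
have bern n : (m.+1 ^ n * (m.+1 + n) <= m.+2 ^ n * m.+1)%N.
  elim: n => [|n IH]; first by rewrite !expn0; lia.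
  rewrite !expnS; nia.
have := bern (C * m.+1)%N; have := Hm (C * m.+1)%N.
have : (0 < m.+1 ^ (C * m.+1))%N by rewrite expn_gt0.
nia.
Qed.

(* Otherwise the cofinite filter on [K] would cluster at some point, although it
   contains the complement of that point. *)
Lemma discrete_compact_finite (S : choiceType) (K : set (discrete_topology S)) :
  compact K -> finite_set K.
Proof.
move=> cK; apply: contrapT => infK.
pose F : set_system (discrete_topology S) := fun A => finite_set (K `\` A).
have FF : ProperFilter F.
  split; first by rewrite /F setD0.
  split=> [|A B FA FB|A B AB]; rewrite /F.
  - by rewrite setDT; exact: finite_set0.
  - by rewrite setDIr finite_setU.
  - by apply: sub_finite_set => x [Kx nBx]; split=> // /AB.
have [|x [Kx clx]] := cK F FF; first by rewrite /F setDv; exact: finite_set0.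
have [|y [/= yx]] := clx (~` [set x]) [set x] _ (discrete_set1 x).
  by rewrite /F setDE setCK; apply: sub_finite_set (finite_set1 x) => y [].
exact: yx.
Qed.

(** * Finiteness of sets of cosets *)

Lemma left_coset_continuous (G : topologicalGroupType) (V : set G) :
  subgroup V -> open V ->
  continuous (fun x => left_coset x V : discrete_topology (set G)).
Proof.
move=> sV oV x; apply/discrete_cvg.
have cx : continuous (fun y => x^-1 * y).
  move=> y; apply: (@continuous_comp _ _ _ (fun y => (x^-1, y))
    (fun z : G * G => z.1 * z.2)); last exact: mulg_continuous.
  by apply: (@cvg_pair _ _ _ _ (nbhs x^-1)); [exact: cvg_cst|exact: cvg_id].
(* The coset map is constant on the open neighbourhood [x V] of [x]. *)
have : nbhs x ((fun y => x^-1 * y) @^-1` V).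
  apply: open_nbhs_nbhs; split; first by apply: open_comp => // y _; exact: cx.
  by rewrite /preimage /= mulVg; exact: subgroup1.
by apply: filterS => y Vy; apply/esym/eq_left_coset.
Qed.

Lemma compact_finite_cosets (G : topologicalGroupType) (B V : set G) :
  subgroup V -> open V -> compact B -> finite_set [set left_coset a V | a in B].
Proof.
move=> sV oV cB; apply: (@discrete_compact_finite (set G)).
apply: continuous_compact cB; apply: continuous_subspaceT.
exact: left_coset_continuous.
Qed.

Section LocalCompactness.
Variables (G : topologicalGroupType) (T Tinv : G -> G) (U : set G).
Hypotheses (TK : cancel T Tinv) (TinvK : cancel Tinv T).
Hypothesis TM : {morph T : x y / x * y}.
Hypotheses (sU : subgroup U) (mU : memoryless T Tinv U).

Let X := range (coding T Tinv U).

Let pt (x : G) : set_type X :=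
  exist (fun c => c \in X) (coding T Tinv U x) (mem_set (ex_intro2 _ _ x I erefl)).

Lemma compact_cylinder : exists2 K : set (set_type X), compact K &
  exists N : nat, forall x,
    (forall j, (`|j| <= N)%N -> U (zpow T Tinv j x)) -> K (pt x).
Proof.
have [_ _ /(_ (pt 1) I)[K nK [cK _]]] := mU; exists K => //.
have {nK} : nbhs (pt 1) K.
  by apply: (@filterS _ (nbhs (pt 1)) _ _ _ _ nK) => y Ky; exact: Ky.
move=> [_ [[B oB <-] /= B1 BK]].
apply: contrapT => noN.
have /choice[x xP] N : exists x,
    (forall j, (`|j| <= N)%N -> U (zpow T Tinv j x)) /\ ~ B (coding T Tinv U x).
  apply: contrapT => nx; apply: noN; exists N => x Hx.
  by apply: BK => /=; apply: contrapT => nB; apply: nx; exists x.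
(* Agreement with the identity on growing windows forces pointwise convergence to its itinerary,
   although every term avoids the neighbourhood [B]. *)
have : (fun N => coding T Tinv U (x N)) @ \oo -->
    (coding T Tinv U 1 : {ptws int -> discrete_topology (set G)}).
  apply/(@pointwise_cvgP (discrete_topology int) (discrete_topology (set G))).
  move=> j; apply/discrete_cvg; exists `|j|%N => // N /= jN.
  by apply/(coding1 TK TinvK TM _ _ sU); have [+ _] := xP N; apply.
move=> /(_ B) []; first exact: open_nbhs_nbhs.
by move=> N _ /(_ N (leqnn N)); have [] := xP N.
Qed.

Lemma memoryless_finite_predecessors :
  finite_set [set left_coset a U | a in Tinv @` U].
Proof.
have spl := memoryless_splicing mU.
have [K cK [N HN]] := compact_cylinder.
(* The last time before the window [[-N, N]] that forces membership in [K]. *)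
pose j0 : int := (- (N.+1 : int))%R.
pose pr (c : set_type X) : discrete_topology (set G) := set_val c j0.
have cpr : continuous pr.
  move=> c; apply: (@continuous_comp _ {ptws int -> discrete_topology (set G)} _
    set_val (fun f => f j0)).
    exact: initial_continuous.
  exact: (@proj_continuous _ (fun=> discrete_topology (set G))).
have : finite_set (pr @` K).
  apply: (@discrete_compact_finite (set G)); apply: continuous_compact cK.
  exact: continuous_subspaceT.
apply: sub_finite_set => _ [_ [u Uu <-] <-].
have zy : zpow T Tinv (- (N : int))%R (iter N T u) = u.
  by rewrite -[iter N T u]/(zpow T Tinv (N : int) u) -zpowD // addNr.
(* The point [z] passes through the symbol of [Tinv u] at time [-N - 1] and follows the identity
   from time [-N] on. *)
have [|z [zpast zfut]] := spl (iter N T u) 1 (- (N : int))%R.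
  by apply/coding1 => //; rewrite zy.
exists (pt z).
  by apply: HN => j jN; apply/(coding1 TK TinvK TM _ _ sU)/zfut; lia.
rewrite /pr set_valE /= zpast; last by rewrite /j0; lia.
rewrite /coding (_ : j0 = - (N : int) - 1)%R; last by rewrite /j0; lia.
by rewrite zpowB1 // zy.
Qed.

End LocalCompactness.

(** * The scale as a number of cosets *)

Lemma compact_covered (G : topologicalGroupType) (B V : set G) :
  subgroup V -> open V -> compact B -> exists k, covered B V k.
Proof.
move=> sV oV cB; have /finite_setP[k Bk] := compact_finite_cosets sV oV cB.
by exists k; exact: card_cosets_covered.
Qed.

(* [T^n U] contains [d^n] points in distinct cosets of [U] but, for any compact
   open [V] of displacement index [m], is covered by [C m^n] cosets of [U]. *)
Lemma card_cosets_scale (G : topologicalGroupType) (T Tinv : G -> G) (U : set G) :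
  cancel T Tinv -> cancel Tinv T -> {morph T : x y / x * y} ->
  compact_open_subgroup U -> splicing T Tinv U ->
  (forall n x i, U x -> U (iter n T x) -> (i <= n)%N -> U (iter i T x)) ->
  finite_set [set left_coset a U | a in T @` U] ->
  [set left_coset a U | a in T @` U] #= `I_(scale T).
Proof.
move=> TK TinvK TM [sU cU oU] spl stay /finite_setP[d Ud].
suff -> : scale T = d by [].
have minD m : displacement_indices T m -> (d <= m)%N.
  move=> [V [sV cV oV] /(index_covered TM sV) Vm].
  have [k UV] := compact_covered sV oV cU.
  have [l VU] := compact_covered sU oU cV.
  apply: (@expn_growth_leq _ _ (k * l)%N) => n.
  have sep := separated_iter n TK TinvK TM sU spl stay
    (card_cosets_separated sU Ud).
  (* [T^n U] is covered by [k] cosets of [T^n V], each of these by [m ^ n] cosets of [V], and each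
     of those by [l] cosets of [U]. *)
  apply: separated_leq_covered sU sep _; rewrite mulnAC.
  apply: covered_trans VU; apply: covered_trans (covered_iter n TM Vm).
  exact: covered_image (morph_iter TM n) UV.
(* The value [d] is the displacement index of [U] itself, so the minimum is attained and the default
   0 is not what [scale] returns. *)
apply: xget_unique; first split=> //.
  by exists U => //; apply/has_indexI => //; exact: subgroup_image.
move=> m [Dm minm]; apply/eqP; rewrite eqn_leq minD // andbT; apply: minm.
by exists U => //; apply/has_indexI => //; exact: subgroup_image.
Qed.

(** Left translation by [T x] carries the cosets of [U] meeting [T U] onto the followers of [x U],
    so the count is the same for all symbols. *)
Lemma card_follower_set (G : topologicalGroupType) (T : G -> G) (U A : set G) :
  {morph T : x y / x * y} -> subgroup U -> cosets U A ->
  follower_set T U A #= [set left_coset a U | a in T @` U].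
Proof.
move=> TM sU [x _ <-].
have -> : follower_set T U (left_coset x U) =
    [set left_coset (T x * a) U | a in T @` U].
  apply/seteqP; split=> [B [cB [_ [[_ [u Uu <-] <-] Bxu]]]|_ [_ [u Uu <-] <-]].
    by exists (T u); [exists u|rewrite -TM; exact/esym/cosets_eq].
  split; first by exists (T x * T u).
  exists (T x * T u); split; last exact: left_coset_refl.
  by exists (x * u); [exists u|exact: TM].
apply: card_image_kernel => a b _ _.
by rewrite !eq_left_coset // invgM -mulgA mulKg.
Qed.

Theorem mainTheorem2 (G : topologicalGroupType)
  (G_hausdorff : hausdorff_space G)
  (G_second_countable : @second_countable G)
  (G_locally_compact : locally_compact [set: G])
  (G_totally_disconnected : totally_disconnected [set: G])
  (T Tinv : G -> G)
  (TM : {morph T : x y / x * y})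
  (TK : cancel T Tinv) (TinvK : cancel Tinv T)
  (T_continuous : continuous T)
  (bounded_not_dense :
    ~ dense [set x : G | compact (closure (zorbit T Tinv x))])
  (H U : nat -> set G)
  (HU : structure_data T Tinv H U)
  (n : nat) (A : set G) (A_symbol : cosets (U n) A) :
  follower_set T (U n) A #= `I_(scale T) /\
  predecessor_set T (U n) A #= `I_(scale Tinv).
Proof.
have [/(_ n) cH /(_ n) /memoryless_splicing splH _ _
  /(_ n) cU /(_ n) mU /(_ n) PU /(_ n) UF] := HU.
have splU := memoryless_splicing mU.
have [sU kU oU] := cU.
have stay k x i : U n x -> U n (iter k T x) -> (i <= k)%N -> U n (iter i T x).
  exact: orbit_segment_stays PU UF.
split.
  apply: card_eq_trans (card_follower_set TM sU A_symbol) _.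
  apply: (card_cosets_scale TK TinvK) => //.
  apply: compact_finite_cosets => //; apply: continuous_compact kU.
  exact: continuous_subspaceT.
have TinvM := can_morphM TK TinvK TM.
(* This turns predecessors under [T] into followers under [Tinv]. *)
have preimE : T @^-1` A = Tinv @` A.
  apply/seteqP; split=> [y Ay|_ [y Ay <-]]; first by exists (T y).
  by rewrite /preimage /= TinvK.
rewrite /predecessor_set preimE -/(follower_set Tinv (U n) A).
apply: card_eq_trans (card_follower_set TinvM sU A_symbol) _.
apply: (card_cosets_scale TinvK TK) => //; first exact: splicing_sym.
  move=> k x i Ux Ukx ik.
  (* A backward segment is the forward segment from [Tinv^k x] to [x], read in reverse. *)
  have -> : iter i Tinv x = iter (k - i) T (iter k Tinv x).
    by rewrite -{2}(subnK ik) iterD (can_iter _ TinvK).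
  by apply: (stay k) => //; [rewrite (can_iter _ TinvK)|exact: leq_subr].
exact: memoryless_finite_predecessors.
Qed.
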